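(* Let $s\in[0,1]$ and let $\overline{u} \in [L^2(\Omega),H^1_0(\Omega)]_s$. Let $u_\varrho \in H^1_0(\Omega)$ be the unique solution of $$B^* A^{-1}_{1/\varrho} B u_\varrho + u_\varrho = \overline{u} \quad \text{in } H^{-1}(\Omega).$$ Then there holds the error estimate $$\| u_\varrho - \overline{u} \|_{L^2(\Omega)} \leq \| \overline{u} \|_{H^s_\varrho(\Omega)} .$$
   Context: $\Omega \subset \mathbb{R}^n$, $n\in\{1,2,3\}$, is a bounded Lipschitz domain, and $\langle\cdot,\cdot\rangle_\Omega$ denotes the duality pairing between $H^{-1}(\Omega)$ and $H^1_0(\Omega)$, extending the $L^2(\Omega)$ inner product. The function $\varrho \in L^\infty(\Omega)$ satisfies $0<\underline{\varrho} \leq \varrho(x) \leq \overline{\varrho}<\infty$ for almost all $x\in\Omega$, with constants $\underline{\varrho},\overline{\varrho}$. The operators $A_{1/\varrho}, B : H^1_0(\Omega)\to H^{-1}(\Omega)$ are defined by $$\langle A_{1/\varrho} w , v \rangle_\Omega = \int_\Omega \frac{1}{\varrho(x)} \nabla w(x)\cdot\nabla v(x)\,dx, \qquad \langle B u , v\rangle_\Omega = \int_\Omega \nabla u(x)\cdot \nabla v(x)\,dx$$ for all $u,v,w\in H^1_0(\Omega)$, and $B^*: H^1_0(\Omega)\to H^{-1}(\Omega)$ is the adjoint of $B$. The operator equation is understood in variational form, tested with all $v\in H^1_0(\Omega)$. $[L^2(\Omega),H^1_0(\Omega)]_s$ denotes the interpolation space between $L^2(\Omega)$ ($s=0$) and $H^1_0(\Omega)$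 ($s=1$). Weighted norms: consider the (weak) eigenvalue problem $$-\operatorname{div}[\varrho(x)\nabla v(x)] = \lambda\, v(x) \ \text{ for } x\in\Omega,\quad v(x)=0 \ \text{ for } x\in\partial\Omega,\quad \|v\|_{L^2(\Omega)}=1,$$ whose eigenfunctions $\{v_i\}_{i\in\mathbb{N}}$ form an orthonormal basis of $L^2(\Omega)$, with positive eigenvalues $\lambda_i=\lambda_i(\varrho)$ tending to infinity as $i \to \infty$. For $s\in[0,1]$ define $$\|u\|_{H^s_\varrho(\Omega)}^2 := \sum_{i=1}^\infty \lambda_i^s\, u_i^2,\qquad u_i = \langle u,v_i\rangle_{L^2(\Omega)}.$$ In particular $\|u\|_{H^0_\varrho(\Omega)}=\|u\|_{L^2(\Omega)}$, and $\|u\|_{H^1_\varrho(\Omega)}^2=\int_\Omega\varrho(x)|\nabla u(x)|^2dx$ for $u\in H^1_0(\Omega)$. *)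

(* Defs.v *)
From HB Require Import structures.
From mathcomp Require Import all_boot all_order all_algebra.
From mathcomp Require Import all_classical all_reals all_analysis.

Set Implicit Arguments.
Unset Strict Implicit.
Unset Printing Implicit Defensive.

Import Order.TTheory GRing.Theory Num.Theory.
Import numFieldNormedType.Exports.

Local Open Scope classical_set_scope.
Local Open Scope ring_scope.

(* ['rV[R]_n] carries the sigma-algebra generated by the coordinate maps, as
   the library does for [n.-tuple]; over R this is the Borel sigma-algebra of
   the usual topology of R^n. *)
Fact rV_display : measure_display. Proof. exact: default_measure_display. Qed.

Section measurable_rV.
Context {R : realType} (n : nat).

Definition rV_measurable : set (set 'rV[R]_n) :=
  g_sigma_preimage (fun (i : 'I_n) (x : 'rV[R]_n) => x ord0 i).

Let rV_set0 : rV_measurable set0.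
Proof. exact: sigma_algebra0. Qed.

Let rV_setC A : rV_measurable A -> rV_measurable (~` A).
Proof. exact: sigma_algebraC. Qed.

Let rV_bigcup (F : _^nat) : (forall i, rV_measurable (F i)) ->
  rV_measurable (\bigcup_i (F i)).
Proof. exact: sigma_algebra_bigcup. Qed.

HB.instance Definition _ := @isMeasurable.Build rV_display
  'rV[R]_n rV_measurable rV_set0 rV_setC rV_bigcup.

Lemma measurable_coord (i : 'I_n) :
  measurable_fun [set: 'rV[R]_n] (fun x : 'rV[R]_n => x ord0 i).
Proof.
move=> _ Y mY; rewrite setTI; apply: sub_sigma_algebra => /=.
rewrite -bigcup_seq/=; exists i => /=; first by rewrite mem_index_enum.
by exists Y => //; rewrite setTI.
Qed.

Lemma measurable_fun_coordP d (T : measurableType d) (f : T -> 'rV[R]_n) :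
  (forall i, measurable_fun [set: T] (fun x => f x ord0 i)) ->
  measurable_fun [set: T] f.
Proof.
move=> mf.
have sub : g_sigma_preimage (fun (i : 'I_n) x => f x ord0 i) `<=` measurable.
  apply: smallest_sub; first exact: sigma_algebra_measurable.
  rewrite -bigcup_seq; apply: bigcup_sub => i _.
  by move=> A [B mB <-]; exact: mf.
move=> _ Y mY; apply: sub.
rewrite (g_sigma_preimage_comp (fun (i : 'I_n) (x : 'rV[R]_n) => x ord0 i) f).
by exists Y.
Qed.

End measurable_rV.

Section lebesgue_rV.
Context {R : realType}.

Definition cons_rV n (p : R * 'rV[R]_n) : 'rV[R]_n.+1 :=
  \row_i oapp (fun j => p.2 ord0 j) p.1 (unlift ord0 i).

Definition uncons_rV n (x : 'rV[R]_n.+1) : R * 'rV[R]_n :=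
  (x ord0 ord0, \row_j x ord0 (lift ord0 j)).

Lemma uncons_rVK n : cancel (@uncons_rV n) (@cons_rV n).
Proof.
move=> x; apply/rowP => i; rewrite mxE /=.
by case: unliftP => [j ->|->] //=; rewrite mxE.
Qed.

Lemma cons_rVK n : cancel (@cons_rV n) (@uncons_rV n).
Proof.
move=> [a y]; rewrite /uncons_rV mxE unlift_none /=; congr pair.
by apply/rowP => j; rewrite !mxE liftK.
Qed.

Lemma measurable_cons_rV n : measurable_fun setT (@cons_rV n).
Proof.
apply: measurable_fun_coordP => i.
case: (unliftP ord0 i) => [j ->|->].
  rewrite (_ : (fun x => _) = (fun x : 'rV[R]_n => x ord0 j) \o snd).
    by apply: measurableT_comp => //; exact: measurable_coord.
  by apply/funext => x /=; rewrite mxE liftK.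
rewrite (_ : (fun x => _) = fst) //.
by apply/funext => x /=; rewrite mxE unlift_none.
Qed.

Lemma measurable_uncons_rV n : measurable_fun setT (@uncons_rV n).
Proof.
apply: measurable_fun_pair; first exact: measurable_coord.
apply: measurable_fun_coordP => i.
by under eq_fun do rewrite mxE; exact: measurable_coord.
Qed.

Section step.
Context (nu : {sigma_finite_measure set (measurableTypeR R) -> \bar R}).
Context n (mu : {sigma_finite_measure set 'rV[R]_n -> \bar R}).

Definition product_rV : set 'rV[R]_n.+1 -> \bar R :=
  pushforward (nu \x mu)%E (@cons_rV n).


Let product_rV0 : product_rV set0 = 0%E.
Proof. by rewrite /product_rV /pushforward preimage_set0 measure0. Qed.

Let product_rV_ge0 A : (0 <= product_rV A)%E.
Proof. by rewrite /product_rV /pushforward; exact: measure_ge0. Qed.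

Let mpre A : measurable A -> measurable (@cons_rV n @^-1` A).
Proof. by move=> mA; rewrite -[X in measurable X]setTI; exact: measurable_cons_rV. Qed.

Let product_rV_sigma_additive : semi_sigma_additive product_rV.
Proof.
move=> F mF tF mUF; rewrite /product_rV /pushforward preimage_bigcup.
apply: measure_semi_sigma_additive.
- by move=> k; exact: mpre.
- apply/trivIsetP => /= i j _ _ ij; rewrite -preimage_setI.
  by move/trivIsetP : tF => /(_ _ _ _ _ ij) ->//; rewrite preimage_set0.
- by rewrite -preimage_bigcup; exact: mpre.
Qed.

HB.instance Definition _ := isMeasure.Build _ _ _ product_rV
  product_rV0 product_rV_ge0 product_rV_sigma_additive.

Let product_rV_sigma_finite : sigma_finite setT product_rV.
Proof.
have /sigma_finiteP[F [FT ndF mF]] := sigma_finiteT nu.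
have /sigma_finiteP[G [GT ndG mG]] := sigma_finiteT mu.
exists (fun k => @uncons_rV n @^-1` (F k `*` G k)).
  rewrite -preimage_bigcup -(preimage_setT (@uncons_rV n)); congr (_ @^-1` _).
  apply/esym; rewrite -subTset => -[x y] _.
  have [i _ Fix] : (\bigcup_i F i) x by rewrite -FT.
  have [j _ Gjy] : (\bigcup_i G i) y by rewrite -GT.
  exists (maxn i j) => //; split => /=.
    by move: x Fix; exact/subsetPset/ndF/leq_maxl.
  by move: y Gjy; exact/subsetPset/ndG/leq_maxr.
move=> k; have [mFk Fk] := mF k; have [mGk Gk] := mG k.
have mFG : measurable (F k `*` G k) by exact: measurableX.
split; first by rewrite -[X in measurable X]setTI; exact: measurable_uncons_rV.
rewrite /product_rV /pushforward -comp_preimage.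
rewrite (_ : @uncons_rV n \o @cons_rV n = id) ?preimage_id; last first.
  by apply/funext => p; exact: cons_rVK.
by rewrite product_measure1E// lte_mul_pinfty// ge0_fin_numE.
Qed.

HB.instance Definition _ := @Measure_isSigmaFinite.Build _ _ _ product_rV
  product_rV_sigma_finite.

End step.

(* Lebesgue measure on R^n, as the n-fold product of Lebesgue measure on R *)
Fixpoint lebesgue_rV n : {sigma_finite_measure set 'rV[R]_n -> \bar R} :=
  match n with
  | 0 => \d_(0 : 'rV[R]_0)
  | n'.+1 => product_rV lebesgue_measure (lebesgue_rV n')
  end.

End lebesgue_rV.

Section lipschitz_domain.
Context {R : realType} {n : nat}.

(* Around every boundary point there are Cartesian coordinates [y = x Q], with
   [Q] orthogonal, in which [Omega] is the part above the graph of a Lipschitz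
   function of the first [n - 1] coordinates. Such an [n] is positive, and [k]
   below ranges over the single index of the last coordinate. Balls are taken
   in the sup norm of ['rV[R]_n]. *)
Definition lipschitz_boundary (Omega : set 'rV[R]_n) :=
  forall x0, (closure Omega `\` Omega) x0 ->
  exists (Q : 'M[R]_n) (g : 'rV[R]_n.-1 -> R) (L r : R),
    [/\ Q *m Q^T = 1%:M, L.-lipschitz g, 0 < r &
      forall x, ball x0 r x -> forall k : 'I_n, k.+1 = n ->
        Omega x <->
        g (\row_j (x *m Q) ord0 (widen_ord (leq_pred n) j)) < (x *m Q) ord0 k].

Definition bounded_lipschitz_domain (Omega : set 'rV[R]_n) :=
  [/\ open Omega, connected Omega, Omega !=set0, bounded_set Omega &
    lipschitz_boundary Omega].

End lipschitz_domain.

(* Elements of function spaces on [Omega] are represented by functions on the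
   whole of R^n, whose values outside [Omega] never matter. *)
Section sobolev.
Context {R : realType} {n : nat}.
Local Notation mu := (@lebesgue_rV R n).
Implicit Types (Omega : set 'rV[R]_n) (u v w phi rho : 'rV[R]_n -> R).

Definition L2 Omega : set ('rV[R]_n -> R) :=
  [set u | u \_ Omega \in Lfun mu 2%:E].

Definition L2norm Omega u : \bar R := ('N[mu]_2%:E[EFin \o (u \_ Omega)])%E.

Definition L2inner Omega u v : R := \int[mu]_(x in Omega) (u x * v x).

Definition partial (i : 'I_n) (u : 'rV[R]_n -> R) : 'rV[R]_n -> R :=
  fun x => 'D_(delta_mx ord0 i) u x.

Definition dotp (x y : 'rV[R]_n) : R := \sum_(i < n) x ord0 i * y ord0 i.

(* All iterated partial derivatives are differentiable, hence continuous. *)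
Definition smooth u :=
  forall (s : seq 'I_n) x, differentiable (foldr partial u s) x.

Definition test_function Omega phi :=
  [/\ smooth phi, compact (closure [set x | phi x != 0]) &
    closure [set x | phi x != 0] `<=` Omega].

Definition weak_gradient Omega u (g : 'rV[R]_n -> 'rV[R]_n) :=
  forall (i : 'I_n) phi, test_function Omega phi ->
    L2inner Omega u (partial i phi) = - L2inner Omega (fun x => g x ord0 i) phi.

Definition L2_gradient Omega u : set ('rV[R]_n -> 'rV[R]_n) :=
  [set g : 'rV[R]_n -> 'rV[R]_n | (forall i, L2 Omega (fun x => g x ord0 i)) /\
           weak_gradient Omega u g].

Definition H1 Omega : set ('rV[R]_n -> R) :=
  [set u | L2 Omega u /\ L2_gradient Omega u !=set0].

(* The weak gradient is unique up to a null set of [Omega]; one is chosen. *)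
Definition grad Omega u : 'rV[R]_n -> 'rV[R]_n :=
  xget (fun=> 0) (L2_gradient Omega u).

Definition H1norm Omega u : \bar R :=
  sqrte (L2norm Omega u ^+ 2 +
    \sum_(i < n) L2norm Omega (fun x => grad Omega u x ord0 i) ^+ 2)%E.

(* closure of the test functions in [H1] *)
Definition H10 Omega : set ('rV[R]_n -> R) :=
  [set u | H1 Omega u /\ forall e : R, 0 < e ->
    exists2 phi, test_function Omega phi &
      (H1norm Omega (u \- phi)%R < e%:E)%E].

(* A functional on [H10] is represented by a map on all functions of which only
   the values on [H10] count: equality in the dual H^-1 is [eq_dual], and the
   duality pairing of [F] with [v] is [F v]. *)
Definition dual := ('rV[R]_n -> R) -> R.

Definition eq_dual Omega (F G : dual) := forall v, H10 Omega v -> F v = G v.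

Definition dual_of_L2 Omega u : dual := L2inner Omega u.

Definition opA Omega (a : 'rV[R]_n -> R) (w : 'rV[R]_n -> R) : dual :=
  fun v => \int[mu]_(x in Omega) (a x * dotp (grad Omega w x) (grad Omega v x)).

Definition opB Omega u : dual :=
  fun v => \int[mu]_(x in Omega) dotp (grad Omega u x) (grad Omega v x).

(* adjoint of [T : H10 -> H^-1], with [H10] identified with its bidual *)
Definition adjoint (T : ('rV[R]_n -> R) -> dual) : ('rV[R]_n -> R) -> dual :=
  fun w v => T v w.

(* [inverse Omega T F] is the solution [w] in [H10] of [T w = F]. For [T = opA
   Omega a] with [a] bounded between positive constants and [F] a bounded
   functional, it exists and is unique almost everywhere in [Omega], so that the
   default value 0 is not reached. *)
Definition inverse Omega (T : ('rV[R]_n -> R) -> dual) (F : dual) :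
    'rV[R]_n -> R :=
  xget (fun=> 0) [set w | H10 Omega w /\ eq_dual Omega (T w) F].

Definition dual_add (F G : dual) : dual := fun v => F v + G v.

Definition is_solution Omega rho (ubar u : 'rV[R]_n -> R) :=
  H10 Omega u /\
  eq_dual Omega
    (dual_add
      (adjoint (opB Omega)
        (inverse Omega (opA Omega (fun x => (rho x)^-1)) (opB Omega u)))
      (dual_of_L2 Omega u))
    (dual_of_L2 Omega ubar).

(* Peetre's K-functional of the couple (L2, H10), for the decompositions
   [u = (u - z) + z] *)
Definition Kfun Omega (t : R) u : \bar R :=
  ereal_inf [set (L2norm Omega (u \- z)%R + t%:E * H1norm Omega z)%E |
    z in H10 Omega].

(* [L2, H10]_s: the end point spaces for s = 0 and s = 1; for 0 < s < 1 the real
   interpolation space with second index 2, which for this Hilbert couple is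
   also the complex one and the domain of the power s / 2 of the associated
   operator, with equivalent norms *)
Definition interpolation_space Omega (s : R) : set ('rV[R]_n -> R) :=
  if s == 0 then L2 Omega else if s == 1 then H10 Omega else
  [set u | L2 Omega u /\
    (\int[lebesgue_measure]_(t in `]0%R, +oo[)
       (((t `^ (- s))%:E * Kfun Omega t u) ^+ 2 * (t^-1)%:E) < +oo)%E].

Definition weak_eigenpair Omega rho (lambda : R) v :=
  H10 Omega v /\ forall w, H10 Omega w ->
    \int[mu]_(x in Omega) (rho x * dotp (grad Omega v x) (grad Omega w x)) =
    lambda * L2inner Omega v w.

Definition orthonormal_basis Omega (v : nat -> 'rV[R]_n -> R) :=
  [/\ forall i, L2 Omega (v i),
      forall i j, L2inner Omega (v i) (v j) = (i == j)%:R &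
      forall u, L2 Omega u ->
        (fun N => L2norm Omega
          (fun x => u x - \sum_(i < N) L2inner Omega u (v i) * v i x))
        @ \oo --> 0%E].

(* the norm of H^s_rho, [+oo] if the series diverges *)
Definition Hsnorm Omega (lambda : nat -> R) (v : nat -> 'rV[R]_n -> R) (s : R)
    u : \bar R :=
  sqrte (\sum_(0 <= i <oo) (lambda i `^ s * L2inner Omega u (v i) ^+ 2)%:E)%E.

End sobolev.

(* Main.v *)
(* Let p be the adjoint state, (1/rho) grad p ~ grad u, and write T for the
   energy int |grad p|^2 / rho. Testing the equation with u gives
   T + <u,u> = <ubar,u>, and testing it with eigenfunctions v_i gives
   int grad p . G + <u,f1> = <ubar,f1> for f1 = sum c_i v_i with gradient G. With
   Q = int rho |G|^2 = sum lambda_i c_i^2, this yields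
     |ubar - f1|^2 + Q/2 - |u - ubar|^2
       = |u - f1|^2 + 2 (T - int grad p . G + Q/4) >= 0
   by Young's inequality. Truncating the expansion of ubar to the eigenvalues
   lambda_i < 1 bounds |u - ubar|^2 by sum min(1,lambda_i) ubar_i^2, and
   min(1,lambda) <= lambda^s for every s in [0,1]: no interpolation is needed.

   The gradient of a function is only chosen among its weak gradients, and
   [inverse] may return its default value 0, so one needs that the weak gradient
   of 0 vanishes almost everywhere, i.e. that a function of L2 orthogonal to all
   test functions is 0. It integrates to 0 over small boxes, whose indicators are
   pointwise limits of products of functions exp(-1/t), and hence, by the
   pi-lambda theorem, over all measurable subsets of these boxes. *)
Require Import Defs.
From mathcomp Require Import all_boot all_order all_algebra.
From mathcomp Require Import all_classical all_reals all_analysis.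
From mathcomp Require Import measurable_realfun ring lra.
Import Order.TTheory GRing.Theory Num.Theory.
Import numFieldNormedType.Exports.

Local Open Scope classical_set_scope.
Local Open Scope ring_scope.

(** * Smooth functions and bumps *)

(** The flat function exp(-1/x), extended by 0 to x <= 0. The polynomial factor in 1/x makes the
    family stable under differentiation. *)
Definition expinv {R : realType} (p : {poly R}) (x : R) : R :=
  if 0 < x then p.[x^-1] * expR (- x^-1) else 0.

(** Coefficient by coefficient, y^i <= i! exp(y), since y^i / i! is one term of the exponential
    series. *)
Lemma horner_expRN_bounded {R : realType} (p : {poly R}) :
  exists C : R, forall y : R, 0 <= y -> `|p.[y] * expR (- y)| <= C.
Proof.
exists (\sum_(i < size p) `|p`_i| * i`!%:R) => y y0.
rewrite horner_coef mulr_suml; apply: le_trans (ler_norm_sum _ _ _) _.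
apply: ler_sum => i _; rewrite -mulrA normrM ler_wpM2l//.
rewrite ger0_norm ?mulr_ge0 ?exprn_ge0 ?expR_ge0// expRN ler_pdivrMr ?expR_gt0//.
move: (nat_of_ord i) => {p i} [|i].
  by rewrite expr0 fact0 mul1r -expR0 ler_expR.
rewrite -ler_pdivrMl ?ltr0n ?fact_gt0// mulrC.
by apply: le_trans (expR_ge1Dxn i y0); rewrite lerDr.
Qed.

(** For x > 0, the derivative of p(1/x) exp(-1/x) is x^-2 (p - p')(1/x) exp(-1/x), again of the same
    form. For x < 0 the function is locally 0, and at 0 it is flat. *)
Lemma is_derive_expinv {R : realType} (p : {poly R}) (x : R) :
  is_derive x 1 (expinv p) (expinv ('X^2 * (p - p^`())) x).
Proof.
have [x0|x0|<-] := ltgtP 0 x.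
- apply: (@near_eq_is_derive R R R (fun y => p.[y^-1] * expR (- y^-1))).
    by near=> y; rewrite /expinv ifT//; near: y; exact: lt_nbhsr.
  have xn0 : x != 0 by rewrite gt_eqF.
  have dV : is_derive x 1 (fun y : R => y^-1) (- x ^- 2).
    have := @is_deriveV _ id x 1 1 xn0 (is_derive_id _ _).
    by rewrite /= scaler1.
  have d1 : is_derive x 1 (horner p \o (fun y : R => y^-1)) (p^`().[x^-1] * - x ^- 2).
    exact: is_derive1_comp.
  have d2 : is_derive x 1 (expR \o (fun y : R => - y^-1)) (expR (- x^-1) * - - x ^- 2).
    exact: is_derive1_comp.
  have := is_deriveM d1 d2.
  rewrite /expinv x0 => d; apply: (is_derive_eq d).
  rewrite !hornerE /= exprVn /GRing.scale /=; ring.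
- apply: (@near_eq_is_derive R R R (cst 0)).
    near=> y; rewrite /expinv ifF//; apply/negbTE; rewrite -leNgt ltW//.
    by near: y; exact: lt_nbhsl.
  by rewrite /expinv ltNge (ltW x0)/=; exact: is_derive_cst.
(* At 0: boundedness of y^2 p(y) exp(-y) at y = 1/h gives |[expinv p h]| <= C h^2, so the difference
   quotient is O(h). *)
- have [C hC] := horner_expRN_bounded ('X^2 * p).
  have C0 : 0 <= C by apply: le_trans (hC 0 (lexx _)).
  have bnd h : `|expinv p h| <= C * h ^+ 2.
    rewrite /expinv; case: ifPn => h0; last by rewrite normr0 mulr_ge0 ?sqr_ge0.
    have := hC h^-1; rewrite invr_ge0 => /(_ (ltW h0)).
    have -> : ('X^2 * p).[h^-1] = (h ^+ 2)^-1 * p.[h^-1] by rewrite !hornerE/= exprVn.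
    rewrite -mulrA normrM [`|(h ^+ 2)^-1|]ger0_norm ?invr_ge0 ?sqr_ge0//.
    by rewrite ler_pdivrMl ?exprn_gt0// (mulrC _ C).
  rewrite /expinv ltxx.
  have H : h^-1 *: (expinv p (h *: 1 + 0) - expinv p 0) @[h --> 0^'] --> (0 : R).
    apply/cvgrPdist_le => e e0.
    (* C may be 0, hence the division by C + 1. *)
    have d0 : 0 < e / (C + 1) by rewrite divr_gt0// ltr_wpDl.
    near=> h.
    have h0 : h != 0 by near: h; exact: nbhs_dnbhs_neq.
    rewrite sub0r normrN /GRing.scale /= mulr1 addr0 {2}/expinv ltxx subr0.
    rewrite normrM normfV ler_pdivrMl ?normr_gt0//.
    apply: le_trans (bnd h) _.
    have hd : `|h| < e / (C + 1) by near: h; exact: dnbhs0_lt.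
    have -> : C * h ^+ 2 = `|h| * (C * `|h|) by rewrite -real_normK ?num_real// ; ring.
    rewrite ler_wpM2l//.
    have : (C + 1) * `|h| <= e by rewrite mulrC -ler_pdivlMr ?ltr_wpDl// ltW.
    by apply: le_trans; rewrite ler_wpM2r// lerDl.
  apply: DeriveDef; first by apply/cvg_ex; exists 0.
  by apply: cvg_lim => //.
Unshelve. all: by end_near. Qed.

Section elementary.
Context {R : realType} {n : nat}.

(* A class of functions closed under partial derivatives, hence smooth, and
   rich enough to contain the bump functions of boxes. *)
Inductive elementary : ('rV[R]_n -> R) -> Prop :=
| elementary_cst (c : R) : elementary (cst c)
| elementary_expinv (p : {poly R}) (a b : R) (i : 'I_n) :
    elementary (fun x => expinv p (a * x ord0 i + b))
| elementaryD f g : elementary f -> elementary g -> elementary (f + g)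
| elementaryM f g : elementary f -> elementary g -> elementary (f * g).

Lemma is_diff_coord (i : 'I_n) (x : 'rV[R]_n) :
  is_diff x (fun y : 'rV[R]_n => y ord0 i) (fun y : 'rV[R]_n => y ord0 i).
Proof.
(* [diff_lin] speaks of bundled linear maps, so the coordinate map is repackaged as one. *)
have @f : {linear 'rV[R]_n -> R}.
  by exists (fun N : 'rV[R]_n => N ord0 i); do 2![eexists]; do ?[constructor];
     rewrite ?mxE// => ? *; rewrite ?mxE//; move=> ?; rewrite !mxE.
apply: DiffDef; first exact: differentiable_coord.
rewrite (_ : (fun _ => _) = f) // diff_lin//; exact: coord_continuous.
Qed.

Lemma is_diff_expinv_affine (p : {poly R}) (a b : R) (i : 'I_n) (x : 'rV[R]_n) :
  is_diff x (fun y : 'rV[R]_n => expinv p (a * y ord0 i + b))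
    (fun y => expinv ('X^2 * (p - p^`())) (a * x ord0 i + b) * (a * y ord0 i)).
Proof.
have Hc := is_diff_coord i x.
have dc : differentiable (fun y : 'rV[R]_n => y ord0 i) x by exact: ex_diff.
have da : is_derive (x ord0 i) 1 (fun t : R => a * t + b) a.
  by apply: is_derive_eq; rewrite addr0 /GRing.scale/= mulr1.
have dE : is_derive (x ord0 i) 1 (expinv p \o (fun t : R => a * t + b))
   (expinv ('X^2 * (p - p^`())) (a * x ord0 i + b) * a).
  have H := is_derive_expinv p (a * x ord0 i + b).
  exact: (@is_derive1_comp _ (expinv p) (fun t : R => a * t + b) (x ord0 i) _ _ H da).
have de : differentiable (expinv p \o (fun t : R => a * t + b)) (x ord0 i).
  by apply/derivable1_diffP; exact: ex_derive.
have -> : (fun y : 'rV[R]_n => expinv p (a * y ord0 i + b)) =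
  (expinv p \o (fun t : R => a * t + b)) \o (fun y : 'rV[R]_n => y ord0 i) by [].
apply: DiffDef; first exact: differentiable_comp.
rewrite diff_comp// diff1E// diff_val /=.
apply/funext => y /=; rewrite derive1E derive_val /GRing.scale/=; ring.
Qed.

(** Both claims go through one induction: the sum and product rules for the partial derivatives use
    differentiability of the two operands. *)
Lemma elementary_partial f : elementary f ->
  (forall x, differentiable f x) /\ forall i, elementary (partial i f).
Proof.
elim => [c|p a b j|g h _ [dg eg] _ [dh eh]|g h hg [dg eg] hh [dh eh]]; split.
- by move=> x; exact: differentiable_cst.
- move=> i; rewrite (_ : partial i _ = cst 0); first exact: elementary_cst.
  by apply/funext => x; rewrite /partial derive_cst.
- by move=> x; have H := is_diff_expinv_affine p a b j x; exact: ex_diff.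
- move=> i; rewrite (_ : partial i _ = cst (a * (i == j)%:R) *
      (fun x => expinv ('X^2 * (p - p^`())) (a * x ord0 j + b))).
    apply: elementaryM; first exact: elementary_cst.
    exact: elementary_expinv.
  apply/funext => x.
  have H := is_diff_expinv_affine p a b j x.
  rewrite /partial deriveE; last exact: ex_diff.
  rewrite diff_val mxE eqxx/= eq_sym mulrC; congr (_ * _).
- by move=> x; exact: differentiableD.
- move=> i; rewrite (_ : partial i _ = partial i g + partial i h).
    exact: elementaryD.
  by apply/funext => x; rewrite /partial deriveD//; exact: diff_derivable.
- by move=> x; exact: differentiableM.
- move=> i; rewrite (_ : partial i _ = g * partial i h + h * partial i g).
    by apply: elementaryD; apply: elementaryM.
  by apply/funext => x; rewrite /partial deriveM//; exact: diff_derivable.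
Qed.

Lemma elementary_smooth f : elementary f -> smooth f.
Proof.
move=> ef s; have : elementary (foldr partial f s).
  by elim: s => //= i s /elementary_partial[].
by move=> /elementary_partial[].
Qed.

Lemma elementary_prod (I : Type) (r : seq I) (F : I -> 'rV[R]_n -> R) :
  (forall i, elementary (F i)) -> elementary (fun x => \prod_(i <- r) F i x).
Proof.
move=> eF; rewrite (_ : (fun _ => _) = \prod_(i <- r) F i); last first.
  by apply/funext => x; rewrite fct_prodE.
by elim/big_ind: _ => // [|f g]; [exact: elementary_cst|exact: elementaryM].
Qed.

End elementary.

(** * Boxes, and open sets as countable unions of rational boxes *)

Section boxes.
Context {R : realType}.

Definition box {n} (a b : 'I_n -> R) : set 'rV[R]_n :=
  [set x | forall i, a i < x ord0 i < b i].

Definition cbox {n} (a b : 'I_n -> R) : set 'rV[R]_n :=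
  [set x | forall i, a i <= x ord0 i <= b i].

Lemma sub_box_cbox {n} (a b : 'I_n -> R) : box a b `<=` cbox a b.
Proof. by move=> x abx i; have /andP[/ltW-> /ltW->] := abx i. Qed.

Lemma measurable_coord_preimage {n} (i : 'I_n) (A : set R) :
  measurable A -> measurable [set x : 'rV[R]_n | A (x ord0 i)].
Proof.
by move=> mA; have := measurable_coord i measurableT mA; rewrite setTI.
Qed.

Lemma measurable_box {n} (a b : 'I_n -> R) : measurable (box a b).
Proof.
rewrite (_ : box a b = \bigcap_(i in [set: 'I_n])
    [set x : 'rV[R]_n | `]a i, b i[%classic (x ord0 i)]); last first.
  apply/seteqP; split => [x abx i _|x abx i] /=.
    by rewrite in_itv/=; exact: abx.
  by have := abx i I; rewrite /= in_itv.
apply: fin_bigcap_measurable => // i _.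
exact: (@measurable_coord_preimage _ _ `]a i, b i[%classic).
Qed.

Lemma cbox_compact {n} (a b : 'I_n -> R) : compact (cbox a b).
Proof.
rewrite (_ : cbox a b = [set x | forall i, `[a i, b i]%classic (x ord0 i)]).
  by apply: (@rV_compact R n (fun i => `[a i, b i]%classic)) => i; exact: segment_compact.
by apply/seteqP; split => x abx i; have := abx i; rewrite /= in_itv.
Qed.

Lemma cbox_closed {n} (a b : 'I_n -> R) : closed (cbox a b).
Proof.
apply: compact_closed; last exact: cbox_compact.
exact: norm_hausdorff.
Qed.

Lemma lebesgue_box_fin {n} (a b : 'I_n -> R) :
  (lebesgue_rV n (box a b) < +oo)%E.
Proof.
elim: n a b => [|n IH] a b.
  by rewrite /= diracE; case: (_ \in _); rewrite ltry.
rewrite /= /product_rV /pushforward.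
rewrite (_ : _ @^-1` _ = `]a ord0, b ord0[ `*`
    box (fun i => a (lift ord0 i)) (fun i => b (lift ord0 i))); last first.
  apply/seteqP; split => [[t y]/= abx|[t y]/= [/= abt aby] i].
    split => /=.
      by have := abx ord0; rewrite mxE unlift_none/= in_itv.
    by move=> i; have := abx (lift ord0 i); rewrite mxE liftK.
  rewrite mxE; case: unliftP => [j ->|->] /=; first exact: aby.
  by move: abt; rewrite in_itv.
rewrite product_measure1E//; last exact: measurable_box.
rewrite lte_mul_pinfty//.
have := @lebesgue_measure_itv R `]a ord0, b ord0[; rewrite /= => ->.
by case: ifP => //=; rewrite -EFinB.
Qed.

(** Corners of the cube with rational centre [p.1] and half side 1 / ([p.2] + 1). The index type is
    countable, so these cubes serve as a countable base. *)
Definition rat_lo {n} (p : 'rV[rat]_n * nat) (i : 'I_n) : R :=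
  ratr (p.1 ord0 i) - p.2.+1%:R^-1.
Definition rat_hi {n} (p : 'rV[rat]_n * nat) (i : 'I_n) : R :=
  ratr (p.1 ord0 i) + p.2.+1%:R^-1.

(** With half side below e/2 and a rational centre within that distance of x in every coordinate,
    the closed cube stays in the sup-norm ball of radius e around x. *)
Lemma open_rat_box {n} (U : set 'rV[R]_n) x : open U -> U x ->
  exists p, box (rat_lo p) (rat_hi p) x /\ cbox (rat_lo p) (rat_hi p) `<=` U.
Proof.
rewrite openE => /[apply] /nbhs_ballP[e /= e0 xeU].
have [k _ ke] : exists2 k, true & k.+1%:R^-1 < e / 2 :> R.
  have /ltr_add_invr[k] : 0 < e / 2 by rewrite divr_gt0.
  by rewrite add0r; exists k.
have k0 : 0 < k.+1%:R^-1 :> R by rewrite invr_gt0.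
have /choice[q hq] : forall i : 'I_n, exists q : rat, `|x ord0 i - ratr q| < k.+1%:R^-1.
  move=> i; have : x ord0 i - k.+1%:R^-1 < x ord0 i + k.+1%:R^-1.
    by rewrite ltrD2l (lt_trans _ k0)// oppr_lt0.
  move=> /rat_in_itvoo[q]; rewrite in_itv/= => xq.
  by exists q; rewrite ltr_distlC.
exists (\row_i q i, k); split.
  move=> i; rewrite /rat_lo /rat_hi/= mxE.
  by rewrite -ltr_distl hq.
move=> y hy; apply: xeU; split => // j i; rewrite (ord1 j).
have := hy i; rewrite /rat_lo /rat_hi/= mxE -ler_distl => yq.
rewrite /ball /= (splitr e) (le_lt_trans (ler_distD (ratr (q i)) _ _))//.
by rewrite ltrD// ?(lt_trans (hq i))// distrC (le_lt_trans yq).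
Qed.

Lemma open_bigcup_box {n} (U : set 'rV[R]_n) : open U ->
  U = \bigcup_(p in [set p | cbox (rat_lo p) (rat_hi p) `<=` U])
        box (rat_lo p) (rat_hi p).
Proof.
move=> oU; apply/seteqP; split => [x Ux|x [p /= pU px]].
  by have [p [? ?]] := open_rat_box _ _ oU Ux; exists p.
exact/pU/sub_box_cbox.
Qed.

(** The sigma-algebra is generated by the coordinates rather than by the topology; the two meet
    through the countable cover by rational boxes. *)
Lemma open_measurable_rV {n} (U : set 'rV[R]_n) : open U -> measurable U.
Proof.
move=> oU; rewrite (open_bigcup_box _ oU) bigcup_mkcond.
apply: countable_bigcupT_measurable => //.
by move=> p; case: ifP => // _; exact: measurable_box.
Qed.

End boxes.

(** * Smooth bumps increasing to the indicator of a box *)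

Section box_bump.
Context {R : realType} {n : nat}.
Variables (a b : 'I_n -> R).

(** Each factor is flat at one face of the box. The scaling by k + 1 sends its argument to infinity
    inside the box, where exp(-1/t) tends to 1. *)
Definition box_bump (k : nat) (x : 'rV[R]_n) : R :=
  \prod_(i < n) (expinv 1 (k.+1%:R * (x ord0 i - a i)) *
                 expinv 1 (k.+1%:R * (b i - x ord0 i))).

Lemma expinv1_ge0 (t : R) : 0 <= expinv 1 t.
Proof. by rewrite /expinv; case: ifP; rewrite // hornerE mul1r expR_ge0. Qed.

Lemma expinv1_le1 (t : R) : expinv 1 t <= 1.
Proof.
rewrite /expinv; case: ifP => // t0; rewrite hornerE mul1r -[leRHS]expR0 ler_expR.
by rewrite oppr_le0 invr_ge0 ltW.
Qed.

Lemma box_bump_ge0 k x : 0 <= box_bump k x.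
Proof. by apply: prodr_ge0 => i _; rewrite mulr_ge0 ?expinv1_ge0. Qed.

Lemma box_bump_le1 k x : box_bump k x <= 1.
Proof.
have -> : 1 = \prod_(i < n) 1 :> R by rewrite big1.
apply: ler_prod => i _; rewrite mulr_ge0 ?expinv1_ge0//=.
by rewrite mulr_ile1 ?expinv1_ge0 ?expinv1_le1.
Qed.

Lemma box_bump_neq0 k x : box_bump k x != 0 -> box a b x.
Proof.
move=> /prodf_neq0 h i; have := h i isT; rewrite mulf_eq0 negb_or /expinv.
case: ifP => [|_]; last by rewrite eqxx.
rewrite pmulr_rgt0// subr_gt0 => -> /=.
case: ifP => [|_]; last by rewrite eqxx andbF.
by rewrite pmulr_rgt0// subr_gt0.
Qed.

Lemma box_bump_elementary k : elementary (box_bump k).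
Proof.
apply: elementary_prod => i.
rewrite (_ : (fun x : 'rV[R]_n => expinv 1 _ * expinv 1 _) =
  (fun x : 'rV[R]_n => expinv 1 (k.+1%:R * x ord0 i + - (k.+1%:R * a i))) *
  (fun x : 'rV[R]_n => expinv 1 (- k.+1%:R * x ord0 i + k.+1%:R * b i))).
  by apply: elementaryM; exact: elementary_expinv.
by apply/funext => x /=; congr (expinv _ _ * expinv _ _); ring.
Qed.

Lemma box_bump_test_function k (Omega : set 'rV[R]_n) :
  cbox a b `<=` Omega -> test_function Omega (box_bump k).
Proof.
move=> abO; have sub : closure [set x | box_bump k x != 0] `<=` cbox a b.
  rewrite closureE; apply: smallest_sub; first exact: cbox_closed.
  by move=> x /box_bump_neq0; exact: sub_box_cbox.
split; first exact/elementary_smooth/box_bump_elementary.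
  apply: subclosed_compact sub; [exact: closed_closure|exact: cbox_compact].
exact: subset_trans abO.
Qed.

Lemma cvg_expinv1 (c : R) : 0 < c -> expinv 1 (k.+1%:R * c) @[k --> \oo] --> (1 : R).
Proof.
move=> c0.
rewrite (_ : (fun k => _) = (fun k => expR (- (@harmonic R k * c^-1)))); last first.
  by apply/funext => k; rewrite /expinv mulr_gt0// hornerE mul1r invfM.
have h0 : - (@harmonic R k * c^-1) @[k --> \oo] --> (0 : R).
  rewrite -[X in _ --> X]oppr0; apply: cvgN.
  rewrite -[X in _ --> X](mul0r c^-1); apply: cvgM; last exact: cvg_cst.
  exact: cvg_harmonic.
have := @continuous_cvg _ R R _ _ _ expR _ (@continuous_expR R 0) h0.
by rewrite expR0; apply.
Qed.

Lemma cvg_box_bump x : box a b x -> box_bump k x @[k --> \oo] --> (1 : R).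
Proof.
move=> abx; rewrite /box_bump; elim: (index_enum _) => [|i r IH].
  by under eq_fun do rewrite big_nil; exact: cvg_cst.
under eq_fun do rewrite big_cons.
have /andP[ai ib] := abx i.
have := @cvgM _ _ _ _ _ _ _ _ (@cvg_expinv1 (x ord0 i - a i) _) (@cvg_expinv1 (b i - x ord0 i) _).
rewrite !subr_gt0 mulr1 => /(_ _ ai ib) /cvgM /(_ IH).
by rewrite mulr1.
Qed.

End box_bump.

(** * The fundamental lemma of the calculus of variations *)

Section pi_system.
Context {R : realType} {n : nat}.

(** Orthants form a pi-system, and cutting a box by an orthant yields a box again; this is what the
    pi-lambda argument needs. *)
Definition orthant (a : 'I_n -> R) : set 'rV[R]_n := [set x | forall i, a i < x ord0 i].

Lemma measurable_orthant a : measurable (orthant a).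
Proof.
rewrite (_ : orthant a = \bigcap_(i in [set: 'I_n])
    [set x : 'rV[R]_n | `]a i, +oo[%classic (x ord0 i)]); last first.
  apply/seteqP; split => [x abx i _|x abx i] /=.
    by rewrite in_itv/= andbT; exact: abx.
  by have := abx i I; rewrite /= in_itv/= andbT.
apply: fin_bigcap_measurable => // i _.
exact: (@measurable_coord_preimage _ _ _ `]a i, +oo[%classic).
Qed.

Lemma setI_closed_orthant : setI_closed [set orthant a | a in setT].
Proof.
move=> _ _ [a _ <-] [b _ <-]; exists (fun i => Num.max (a i) (b i)) => //.
apply/seteqP; split => [x h|x [ha hb] i].
  by split => i; have := h i; rewrite gt_max => /andP[].
by rewrite gt_max ha hb.
Qed.

(** It suffices to generate the half-spaces x_i > t. Each is the union over k of the orthants with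
    bound t in coordinate i and -k in the others. *)
Lemma orthant_generates (A : set 'rV[R]_n) :
  measurable A -> <<s [set orthant a | a in setT] >> A.
Proof.
move=> mA; move: A mA.
apply: smallest_sub; first exact: smallest_sigma_algebra.
rewrite -bigcup_seq; apply: bigcup_sub => i _.
have mi : measurable_fun [set: g_sigma_algebraType [set orthant a | a in setT]]
    (fun x : 'rV[R]_n => x ord0 i).
  apply: (measurability _ (RGenOInfty.measurableE R)) => /=.
  move=> _ [_ [t ->] <-]; rewrite setTI.
  rewrite (_ : _ @^-1` _ =
      \bigcup_k orthant (fun j => if j == i then t else - k%:R)).
    apply: bigcupT_measurable => k; apply: sub_sigma_algebra.
    by exists (fun j => if j == i then t else - k%:R).
  apply/seteqP; split => [x /=|x [k _ /(_ i)] /=].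
    rewrite in_itv/= andbT => tx.
    have [k hk] : exists k, forall j, - k%:R < x ord0 j.
      have [k hk] : exists k : nat, \sum_j `|x ord0 j| < k%:R.
        by exists (Num.trunc (\sum_j `|x ord0 j|)).+1; exact: truncnS_gt.
      exists k => j; rewrite ltrNl (le_lt_trans _ hk)//.
      rewrite (bigD1 j)//= -[leLHS]addr0 lerD//; last exact: sumr_ge0.
      by rewrite -normrN ler_norm.
    by exists k => // j; case: eqP => [->//|_]; exact: hk.
  by rewrite eqxx in_itv/= andbT.
by move=> _ [B mB <-]; exact: mi.
Qed.

End pi_system.

Lemma elementary_measurable {R : realType} {n : nat} (f : 'rV[R]_n -> R) :
  elementary f -> measurable_fun setT f.
Proof.
elim => [c|p a b i|g h _ mg _ mh|g h _ mg _ mh].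
- exact: measurable_cst.
- apply: (@measurableT_comp _ _ _ _ _ _ (expinv p) _
    (fun x : 'rV[R]_n => a * x ord0 i + b)).
    apply: continuous_measurable_fun => t.
    apply/differentiable_continuous/derivable1_diffP.
    by have H := is_derive_expinv p t; exact: ex_derive.
  by apply: measurable_funD => //; apply: measurable_funM => //; exact: measurable_coord.
- exact: measurable_funD.
- exact: measurable_funM.
Qed.

Section fundamental_lemma.
Context {R : realType} {n : nat}.
Local Notation mu := (@lebesgue_rV R n).

(** The measurable sets A for which h integrates to 0 over A and the box form a Dynkin class
    containing all orthants, hence all measurable sets. A function with vanishing integral over
    every measurable subset is 0 almost everywhere. *)
Lemma ae_eq0_box (h : 'rV[R]_n -> R) (c d : 'I_n -> R) :
  mu.-integrable (box c d) (EFin \o h) ->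
  (forall a b, (forall i, c i <= a i /\ b i <= d i) ->
     (\int[mu]_(x in box a b) (h x)%:E = 0)%E) ->
  {ae mu, forall x, box c d x -> h x = 0}.
Proof.
move=> ih h0; have mB := measurable_box c d.
pose H := [set A | measurable A /\ (\int[mu]_(x in A `&` box c d) (h x)%:E = 0)%E].
have iA A : measurable A -> mu.-integrable (A `&` box c d) (EFin \o h).
  by move=> mA; apply: integrableS ih => //; exact: measurableI.
have dH : dynkin H.
  have HT : H setT.
    split => //; rewrite setTI; apply: h0 => // i.
  split => //.
  - move=> A [mA A0]; split; first exact: measurableC.
    have := HT.2; rewrite -(setUv A) setIUl integral_setU.
    + by rewrite A0 add0e.
    + exact: measurableI.
    + by apply: measurableI => //; exact: measurableC.
    + by rewrite -setIUl setUv setTI; exact: measurable_int ih.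
    + by apply/disj_setPS => x [[? _] []].
  - move=> F tF HF; split; first by apply: bigcup_measurable => k _; exact: (HF k).1.
    rewrite setI_bigcupl integral_bigcup.
    + by apply: eseries0 => k _ _; exact: (HF k).2.
    + exact: trivIset_setIr.
    + by move=> k; apply: measurableI => //; exact: (HF k).1.
    + rewrite -setI_bigcupl; apply: iA.
      by apply: bigcup_measurable => k _; exact: (HF k).1.
have sub : [set A | measurable A] `<=` H.
  move=> A /= mA; have /dynkin_lambda_system lH := dH.
  have := @lambda_system_subset _ _ (@setI_closed_orthant R n) setT H lH.
  apply => //; last exact: orthant_generates.
  move=> _ [a _ <-]; split; first exact: measurable_orthant.
  (* The orthant cuts out of [box c d] the box with lower corner max(a, c), to which [h0]
     applies. *)
  rewrite (_ : _ `&` _ = box (fun i => Num.max (a i) (c i)) d); last first.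
    apply/seteqP; split => [x [ax cdx] i|x h1].
      by rewrite gt_max ax; have /andP[-> ->] := cdx i.
    by split => i; have := h1 i; rewrite gt_max => /andP[/andP[? ?] ?] //; apply/andP.
  by apply: h0 => i; rewrite le_max lexx orbT.
have : ae_eq mu (box c d) (EFin \o h) (cst 0%E).
  apply: integral_ae_eq => // E EB mE; rewrite [RHS]integral0.
  have := (sub _ mE).2; rewrite (_ : E `&` _ = E)//.
  by apply/seteqP; split => [x []//|x Ex]; split => //; exact: EB.
by apply: filterS => x /= + Bx => /(_ Bx)[].
Qed.

Lemma L2_mul_integrable Omega (u w : 'rV[R]_n -> R) : measurable Omega ->
  L2 Omega u -> L2 Omega w -> mu.-integrable Omega (EFin \o (fun x => u x * w x)).
Proof.
move=> mO uL wL; apply/integrable_mkcond => //.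
have /Lfun1_integrable := Lfun2_mul_Lfun1 uL wL.
rewrite (_ : _ \o _ = (EFin \o (fun x : 'rV[R]_n => u x * w x)) \_ Omega)//.
by apply/funext => x; rewrite /= !patchE/=; case: ifP => //; rewrite mul0r.
Qed.

(** A box has finite measure, so its indicator is in L2 and the product with g is integrable. *)
Lemma L2_integrable_box {Omega} (g : 'rV[R]_n -> R) (c d : 'I_n -> R) :
  L2 Omega g -> mu.-integrable (box c d) (EFin \o (g \_ Omega)).
Proof.
move=> gL; have mB := measurable_box c d.
have iB : (\1_(box c d) : 'rV[R]_n -> R) \in Lfun mu 2%:E.
  rewrite inE; apply/andP; split; rewrite inE/=; first exact: measurable_indic.
  rewrite /finite_norm unlock poweR_lty//.
  rewrite (eq_integral (fun x => (\1_(box c d) x)%:E)).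
    by rewrite integral_indic// setIT; exact: lebesgue_box_fin.
  move=> x _; rewrite /= indicE; case: (_ \in _).
    by rewrite normr1 powR1.
  by rewrite normr0 powR0.
have /Lfun1_integrable i1 := Lfun2_mul_Lfun1 gL iB.
apply/(integrable_mkcond _ mB).
rewrite (_ : _ \_ _ = EFin \o ((g \_ Omega) \* \1_(box c d)))//.
apply/funext => x; rewrite [LHS]patchE /= indicE.
by case: ifP => _; rewrite ?mulr1 ?mulr0.
Qed.

(** Bumps of the box are test functions and tend to its indicator, so dominated convergence with
    majorant |g| applies. *)
Lemma test_orthogonal_box Omega (g : 'rV[R]_n -> R) (a b : 'I_n -> R) :
  measurable Omega -> L2 Omega g -> cbox a b `<=` Omega ->
  (forall phi, test_function Omega phi -> L2inner Omega g phi = 0) ->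
  (\int[mu]_(x in box a b) ((g \_ Omega) x)%:E = 0)%E.
Proof.
move=> mO gL abO g0; have mB := measurable_box a b.
have ih := L2_integrable_box _ a b gL.
have mh := measurable_int _ ih.
have mbump k : measurable_fun (box a b) (box_bump a b k).
  by apply: measurable_funTS; apply: elementary_measurable; exact: box_bump_elementary.
have bint k : mu.-integrable (box a b) (EFin \o (fun x => (g \_ Omega) x * box_bump a b k x)).
  apply: le_integrable ih => //.
    apply/measurable_EFinP; apply: measurable_funM => //.
    exact/measurable_EFinP.
  move=> x _; rewrite /= lee_fin normrM ler_piMr// ger0_norm ?box_bump_ge0//.
  exact: box_bump_le1.
have bint0 k : (\int[mu]_(x in box a b) ((g \_ Omega) x * box_bump a b k x)%:E = 0)%E.
  have := g0 _ (box_bump_test_function a b k _ abO).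
  rewrite /L2inner Rintegral_mkcond.
  rewrite (_ : (fun x => g x * box_bump a b k x) \_ Omega =
      (fun x => (g \_ Omega) x * box_bump a b k x) \_ (box a b)).
    rewrite -Rintegral_mkcond /Rintegral => /eqP.
    (* [fine] also sends infinite values to 0; integrability excludes them. *)
    by rewrite fine_eq0 => [/eqP//|]; exact: integrable_fin_num (bint k).
  apply/funext => x; rewrite !patchE.
  case: ifPn => xO; case: ifPn => //; rewrite ?mul0r//.
    rewrite notin_setE; case: (eqVneq (box_bump a b k x) 0) => [->|/box_bump_neq0//].
    by rewrite mulr0.
have [|||||_ _] := @dominated_convergence _ _ _ mu _ mB
  (fun k x => ((g \_ Omega) x * box_bump a b k x)%:E) (fun x => ((g \_ Omega) x)%:E)
  (fun x => `|(g \_ Omega) x|%:E).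
- by move=> k; exact: measurable_int (bint k).
- exact: mh.
- apply/nearW => x Bx; apply/fine_cvgP; split; first exact/nearW.
  rewrite -[X in _ --> X]mulr1; apply: cvgM; first exact: cvg_cst.
  exact: cvg_box_bump.
- by have := integrable_abse ih.
- apply/nearW => x k Bx; rewrite lee_fin normrM ler_piMr// ger0_norm ?box_bump_ge0//.
  exact: box_bump_le1.
under eq_fun do rewrite bint0.
by move/(cvg_lim (@ereal_hausdorff _)) => <-; rewrite lim_cst.
Qed.

(** Countably many rational boxes inside [Omega] cover it, and each contributes a null exceptional
    set. *)
Lemma test_orthogonal_ae_eq0 Omega (g : 'rV[R]_n -> R) :
  open Omega -> L2 Omega g ->
  (forall phi, test_function Omega phi -> L2inner Omega g phi = 0) ->
  {ae mu, forall x, Omega x -> g x = 0}.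
Proof.
move=> oO gL g0; have mO := open_measurable_rV _ oO.
pose B (p : 'rV[rat]_n * nat) := cbox (@rat_lo R n p) (rat_hi p) `<=` Omega.
(* Boxes are numbered through [unpickle], so that [ae_foralln] can merge the null sets; numbers that
   code no admissible box give trivial statements. *)
have ae k : {ae mu, forall x, forall p, unpickle k = Some p -> B p ->
    box (rat_lo p) (rat_hi p) x -> g x = 0}.
  case E : (unpickle k) => [p|]; last by apply/nearW => x q.
  have [pO|npO] := pselect (B p); last by apply/nearW => x q [<-].
  have : {ae mu, forall x, box (rat_lo p) (rat_hi p) x -> (g \_ Omega) x = 0}.
    apply: ae_eq0_box; first exact: L2_integrable_box.
    move=> a b hab; apply: test_orthogonal_box => // x hx.
    apply: pO => i; have /andP[h1 h2] := hx i; have [h3 h4] := hab i.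
    by rewrite (le_trans h3)// (le_trans h2).
  apply: filterS => x hx q [<-] _ bx; rewrite -(hx bx) patchE ifT//.
  by rewrite inE; apply: pO; exact: sub_box_cbox.
have /ae_foralln := ae; apply: filterS => x hx Ox.
have [p [px pO]] := open_rat_box _ _ oO Ox.
by apply: (hx (pickle p) p) => //; rewrite pickleK.
Qed.

End fundamental_lemma.

(** * Weighted forms and the energy estimate *)

(** Inversion is discontinuous at 0, but equals x |x|^-2 everywhere, both sides being 0 at 0. *)
Lemma measurable_invr {R : realType} : measurable_fun setT (@GRing.inv R).
Proof.
rewrite (_ : GRing.inv = fun x : R => x * `|x| `^ (- 2)).
  apply: measurable_funM => //.
  by apply: (measurableT_comp (measurable_powR (-2))).
apply/funext => x; rewrite powRN powR_mulrn// real_normK ?num_real//.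
have [->|x0] := eqVneq x 0; first by rewrite invr0 mul0r.
by rewrite expr2 invfM mulrA mulfV// mul1r.
Qed.

Section weighted_forms.
Context {R : realType} {n : nat} (Omega : set 'rV[R]_n).
Hypothesis mO : measurable Omega.
Local Notation mu := (@lebesgue_rV R n).

Lemma L2D u w : L2 Omega u -> L2 Omega w -> L2 Omega (fun x => u x + w x).
Proof.
rewrite /L2/= => uL wL.
have -> : (fun x => u x + w x) \_ Omega = u \_ Omega + w \_ Omega.
  by apply/funext => x; rewrite /= !fctE !patchE; case: ifP; rewrite ?addr0.
have p1 : (1 <= 2%:E :> \bar R)%E by rewrite lee_fin ler1n.
by apply: (Lfun_addr_closed mu p1).2.
Qed.

Lemma L2Z c u : L2 Omega u -> L2 Omega (fun x => c * u x).
Proof.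
rewrite /L2/= => uL.
have -> : (fun x => c * u x) \_ Omega = c \o* (u \_ Omega).
  by apply/funext => x; rewrite /= !patchE mulrC; case: ifP; rewrite ?mul0r.
by apply: Lfun_scale => //; rewrite ler1n.
Qed.

Lemma L2_0 : L2 Omega (fun=> 0 : R).
Proof.
have p1 : (1 <= 2%:E :> \bar R)%E by rewrite lee_fin ler1n.
rewrite /L2/= (_ : _ \_ _ = 0); first exact: (Lfun_addr_closed mu p1).1.
by apply/funext => x; rewrite patchE; case: ifP.
Qed.

(** The number m of components is free: m = n serves for gradients and m = 1 for scalar functions,
    so one bilinear calculus covers both. *)
Definition L2v {m} : set ('rV[R]_n -> 'rV[R]_m) :=
  [set F | forall i, L2 Omega (fun x => F x ord0 i)].

Lemma L2vD {m} (F G : 'rV[R]_n -> 'rV[R]_m) :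
  L2v F -> L2v G -> L2v (fun x => F x + G x).
Proof.
by move=> FL GL i; under eq_fun do rewrite mxE; exact: L2D.
Qed.

Lemma L2vZ {m} c (F : 'rV[R]_n -> 'rV[R]_m) : L2v F -> L2v (fun x => c *: F x).
Proof. by move=> FL i; under eq_fun do rewrite mxE; exact: L2Z. Qed.

Lemma L2v_sum {m} N (c : nat -> R) (F : nat -> 'rV[R]_n -> 'rV[R]_m) :
  (forall i, L2v (F i)) -> L2v (fun x => \sum_(i < N) c i *: F i x).
Proof.
move=> FL; elim: N => [|N IH].
  by move=> i; under eq_fun do rewrite big_ord0 mxE; exact: L2_0.
under eq_fun do rewrite big_ord_recr/=.
by apply: L2vD => //; exact: L2vZ.
Qed.

Definition wform {m} (a : 'rV[R]_n -> R) (F G : 'rV[R]_n -> 'rV[R]_m) : R :=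
  \int[mu]_(x in Omega) (a x * dotp (F x) (G x)).

Lemma dotp_integrable {m} {F G : 'rV[R]_n -> 'rV[R]_m} : L2v F -> L2v G ->
  mu.-integrable Omega (EFin \o (fun x => dotp (F x) (G x))).
Proof.
move=> FL GL.
rewrite (_ : _ \o _ = (fun x => (\sum_(i < m) (F x ord0 i * G x ord0 i)%:E)%E)).
  by apply: integrable_sum => // i _; exact: (@L2_mul_integrable _ _ _ _ _ mO (FL i) (GL i)).
by apply/funext => x /=; rewrite sumEFin.
Qed.

Lemma dotp_measurable {m} (F G : 'rV[R]_n -> 'rV[R]_m) : L2v F -> L2v G ->
  measurable_fun Omega (fun x => dotp (F x) (G x)).
Proof.
move=> FL GL; apply/measurable_EFinP.
by have := measurable_int _ (dotp_integrable FL GL).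
Qed.

Lemma dotpC {m} (p q : 'rV[R]_m) : dotp p q = dotp q p.
Proof. by apply: eq_bigr => i _; rewrite mulrC. Qed.

Lemma dotpDl {m} (p q r : 'rV[R]_m) : dotp (p + q) r = dotp p r + dotp q r.
Proof. by rewrite -big_split; apply: eq_bigr => i _; rewrite mxE mulrDl. Qed.

Lemma dotpZl {m} c (p q : 'rV[R]_m) : dotp (c *: p) q = c * dotp p q.
Proof. by rewrite mulr_sumr; apply: eq_bigr => i _; rewrite mxE mulrA. Qed.

Lemma dotpp_ge0 {m} (p : 'rV[R]_m) : 0 <= dotp p p.
Proof. by apply: sumr_ge0 => i _; rewrite -expr2 sqr_ge0. Qed.

Lemma wformC {m} a (F G : 'rV[R]_n -> 'rV[R]_m) : wform a F G = wform a G F.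
Proof. by apply: eq_Rintegral => x _; rewrite dotpC. Qed.

Lemma wform_ge0 {m} a (F : 'rV[R]_n -> 'rV[R]_m) :
  (forall x, 0 <= a x) -> 0 <= wform a F F.
Proof. by move=> a0; apply: Rintegral_ge0 => x _; rewrite mulr_ge0 ?dotpp_ge0. Qed.

(** Used to exchange the coefficient for one bounded everywhere, and to ignore the choice of the
    gradient of 0. *)
Lemma wform_ae_eq {m} (a a' : 'rV[R]_n -> R) (F F' G G' : 'rV[R]_n -> 'rV[R]_m) :
  measurable_fun Omega a -> measurable_fun Omega a' ->
  L2v F -> L2v G -> L2v F' -> L2v G' ->
  {ae mu, forall x, Omega x ->
    a x * dotp (F x) (G x) = a' x * dotp (F' x) (G' x)} ->
  wform a F G = wform a' F' G'.
Proof.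
move=> ma ma' FL GL FL' GL' h; congr fine; apply: ae_eq_integral => //.
- apply/measurable_EFinP; apply: measurable_funM => //.
  exact: dotp_measurable.
- apply/measurable_EFinP; apply: measurable_funM => //.
  exact: dotp_measurable.
- by apply: filterS h => x /= + Ox => /(_ Ox) ->.
Qed.

Section bounded_weight.
Variables (a : 'rV[R]_n -> R) (M : R).
Hypotheses (ma : measurable_fun Omega a) (aM : forall x, `|a x| <= M).

Lemma wform_integrable {m} (F G : 'rV[R]_n -> 'rV[R]_m) : L2v F -> L2v G ->
  mu.-integrable Omega (EFin \o (fun x => a x * dotp (F x) (G x))).
Proof.
move=> FL GL; have iFG := dotp_integrable FL GL.
apply: le_integrable (integrableZl mO M iFG) => //.
  apply/measurable_EFinP; apply: measurable_funM => //.
  exact: dotp_measurable.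
move=> x _; rewrite /= lee_fin !normrM ler_wpM2r//.
exact: le_trans (aM x) (ler_norm _).
Qed.

Lemma wformDl {m} (F G H : 'rV[R]_n -> 'rV[R]_m) : L2v F -> L2v G -> L2v H ->
  wform a (fun x => F x + G x) H = wform a F H + wform a G H.
Proof.
move=> FL GL HL; rewrite -RintegralD//; [|exact: wform_integrable..].
by apply: eq_Rintegral => x _; rewrite dotpDl mulrDr.
Qed.

Lemma wformZl {m} c (F G : 'rV[R]_n -> 'rV[R]_m) : L2v F -> L2v G ->
  wform a (fun x => c *: F x) G = c * wform a F G.
Proof.
move=> FL GL; rewrite -RintegralZl//; last exact: wform_integrable.
by apply: eq_Rintegral => x _; rewrite dotpZl mulrCA.
Qed.

Lemma wform_suml {m} N (c : nat -> R) (F : nat -> 'rV[R]_n -> 'rV[R]_m)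
    (G : 'rV[R]_n -> 'rV[R]_m) : (forall i, L2v (F i)) -> L2v G ->
  wform a (fun x => \sum_(i < N) c i *: F i x) G =
  \sum_(i < N) c i * wform a (F i) G.
Proof.
move=> FL GL; elim: N => [|N IH].
  rewrite big_ord0 /wform.
  under eq_Rintegral do rewrite big_ord0 -(scale0r (0 : 'rV[R]_m)) dotpZl mul0r mulr0.
  by rewrite /Rintegral integral0.
rewrite big_ord_recr/= -IH -wformZl// -wformDl//.
- by congr wform; apply/funext => x; rewrite big_ord_recr.
- exact: L2v_sum.
- exact: L2vZ.
Qed.

Lemma wform_diag {m} N (c l : nat -> R) (F : nat -> 'rV[R]_n -> 'rV[R]_m) :
  (forall i, L2v (F i)) ->
  (forall i j, wform a (F i) (F j) = l i * (i == j)%:R) ->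
  let G := fun x => \sum_(i < N) c i *: F i x in
  wform a G G = \sum_(i < N) l i * c i ^+ 2.
Proof.
move=> FL Fl G; have GL : L2v G by exact: L2v_sum.
rewrite wform_suml//; apply: eq_bigr => i _.
rewrite wformC wform_suml//; under eq_bigr do rewrite Fl.
rewrite (bigD1 i)//= eqxx mulr1 big1 ?addr0; first by rewrite expr2; ring.
by move=> j /negbTE; rewrite -val_eqE/= => ->; rewrite !mulr0.
Qed.

(** Expand |p - (k/2) q|^2 >= 0 and divide by k. *)
Lemma dotp_young {m} (k : R) (p q : 'rV[R]_m) : 0 < k ->
  dotp p q <= k^-1 * dotp p p + k * dotp q q / 4.
Proof.
move=> k0; have kn0 : k != 0 by rewrite gt_eqF.
have := dotpp_ge0 (p + (- (k / 2)) *: q).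
rewrite dotpDl dotpZl !(dotpC _ (p + _)) !dotpDl !dotpZl (dotpC q p).
set A := dotp p p; set B := dotp p q; set C := dotp q q => h.
have : 0 <= k^-1 * (A - k / 2 * B - k / 2 * (B - k / 2 * C)).
  by rewrite mulr_ge0 ?invr_ge0 ?(ltW k0)//; lra.
rewrite (_ : _ * _ = k^-1 * A - B + k * C / 4); first lra.
by field.
Qed.

End bounded_weight.

End weighted_forms.

(** * The L2 inner product and orthonormal expansions *)

Section inner_product.
Context {R : realType} {n : nat} {Omega : set 'rV[R]_n}.
Hypothesis mO : measurable Omega.
Local Notation mu := (@lebesgue_rV R n).
Implicit Types u w : 'rV[R]_n -> R.

Definition row1 u (x : 'rV[R]_n) : 'rV[R]_1 := const_mx (u x).

Lemma L2v_row1 u : L2 Omega u -> L2v Omega (row1 u).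
Proof. by move=> uL i; under eq_fun do rewrite mxE. Qed.

Lemma L2inner_wform u w :
  L2inner Omega u w = wform Omega (cst 1) (row1 u) (row1 w).
Proof.
by apply: eq_Rintegral => x _; rewrite /= mul1r /dotp big_ord1 !mxE.
Qed.

Let m1 : measurable_fun Omega (cst 1 : 'rV[R]_n -> R).
Proof. exact: measurable_cst. Qed.

Let le1 (x : 'rV[R]_n) : `|cst 1 x : R| <= 1.
Proof. by rewrite normr1. Qed.

Lemma L2innerC u w : L2inner Omega u w = L2inner Omega w u.
Proof. by rewrite !L2inner_wform wformC. Qed.

Lemma L2inner_ge0 u : 0 <= L2inner Omega u u.
Proof. by rewrite L2inner_wform wform_ge0. Qed.

Lemma L2inner_suml N (c : nat -> R) (v : nat -> 'rV[R]_n -> R) w :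
  (forall i, L2 Omega (v i)) -> L2 Omega w ->
  L2inner Omega (fun x => \sum_(i < N) c i * v i x) w =
  \sum_(i < N) c i * L2inner Omega (v i) w.
Proof.
move=> vL wL.
under eq_bigr do rewrite L2inner_wform.
rewrite -(wform_suml _ mO _ _ m1 le1 N c (fun i => row1 (v i))); last 2 first.
- by move=> i; exact: L2v_row1.
- exact: L2v_row1.
rewrite L2inner_wform; congr wform; apply/funext => x.
by apply/rowP => j; rewrite mxE summxE; apply: eq_bigr => i _; rewrite !mxE.
Qed.

Lemma L2B u w : L2 Omega u -> L2 Omega w -> L2 Omega (fun x => u x - w x).
Proof.
move=> uL wL; under eq_fun do rewrite -mulN1r.
by apply: L2D => //; exact: L2Z.
Qed.

Lemma L2_sum N (c : nat -> R) (v : nat -> 'rV[R]_n -> R) :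
  (forall i, L2 Omega (v i)) -> L2 Omega (fun x => \sum_(i < N) c i * v i x).
Proof.
move=> vL; have vvL i : L2v Omega (row1 (v i)) by exact: L2v_row1.
have := L2v_sum _ N c _ vvL ord0; congr (L2 Omega _); apply/funext => x.
by rewrite summxE; apply: eq_bigr => i _; rewrite !mxE.
Qed.

Lemma L2inner_subr_sqr u w : L2 Omega u -> L2 Omega w ->
  L2inner Omega (fun x => u x - w x) (fun x => u x - w x) =
  L2inner Omega u u - 2 * L2inner Omega u w + L2inner Omega w w.
Proof.
move=> uL wL; rewrite !L2inner_wform.
have Uv := L2v_row1 _ uL; have Wv := L2v_row1 _ wL.
have NWv := L2vZ _ (-1) _ Wv.
have -> : row1 (fun x => u x - w x) = (fun x => row1 u x + (-1) *: row1 w x).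
  by apply/funext => x; apply/rowP => j; rewrite !mxE mulN1r.
have D F : L2v Omega F ->
    wform Omega (cst 1) (fun x => row1 u x + (-1) *: row1 w x) F =
    wform Omega (cst 1) (row1 u) F - wform Omega (cst 1) (row1 w) F.
  move=> FL; rewrite (wformDl _ mO _ _ m1 le1)// (wformZl _ mO _ _ m1 le1)//.
  by rewrite mulN1r.
rewrite D; last exact: L2vD.
rewrite ![wform _ _ _ (fun x => row1 u x + _)]wformC !D//.
rewrite (wformC _ _ (row1 w)); ring.
Qed.

Lemma L2norm_sqrt u : L2 Omega u ->
  L2norm Omega u = (Num.sqrt (L2inner Omega u u))%:E.
Proof.
move=> uL; rewrite /L2norm unlock poweR12_sqrt; last first.
  by apply: integral_ge0 => x _; exact: poweR_ge0.
have -> : (\int[mu]_x `|(EFin \o u \_ Omega) x| `^ 2 = (L2inner Omega u u)%:E)%E.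
  rewrite /L2inner /Rintegral fineK; last first.
    exact: (integrable_fin_num mO (L2_mul_integrable _ _ _ mO uL uL)).
  rewrite integral_mkcond; apply: eq_integral => x _.
  rewrite /= powR_mulrn// real_normK ?num_real// !patchE.
  by case: ifP; rewrite ?expr0n.
by [].
Qed.

Definition residual N (c : nat -> R) (v : nat -> 'rV[R]_n -> R) u x :=
  u x - \sum_(i < N) c i * v i x.

Lemma L2_residual N (c : nat -> R) (v : nat -> 'rV[R]_n -> R) u :
  (forall i, L2 Omega (v i)) -> L2 Omega u -> L2 Omega (residual N c v u).
Proof. by move=> vL uL; apply: L2B => //; exact: L2_sum. Qed.

(** The coefficients are arbitrary, so that the residuals of the full and of the truncated expansion
    can be compared term by term. *)
Lemma orthonormal_residual N (c : nat -> R) (v : nat -> 'rV[R]_n -> R) u :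
  (forall i, L2 Omega (v i)) ->
  (forall i j, L2inner Omega (v i) (v j) = (i == j)%:R) -> L2 Omega u ->
  L2inner Omega (residual N c v u) (residual N c v u) = L2inner Omega u u +
    \sum_(i < N) (c i ^+ 2 - 2 * c i * L2inner Omega u (v i)).
Proof.
move=> vL von uL; have sL := L2_sum N c v vL.
pose f := fun x => \sum_(i < N) c i * v i x.
rewrite (L2inner_subr_sqr u f)// (L2innerC u f) !L2inner_suml// mulr_sumr -sumrN.
rewrite -addrA -big_split/=; congr (_ + _); apply: eq_bigr => i _.
rewrite (L2innerC (v i) f) L2inner_suml//.
rewrite (bigD1 i)//= von eqxx big1 => [|j /negbTE ji]; last first.
  by rewrite von -val_eqE/= in ji *; rewrite ji mulr0.
by rewrite (L2innerC _ u) addr0 mulr1; ring.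
Qed.

End inner_product.

Section energy.
Context {R : realType} {n : nat} {Omega : set 'rV[R]_n}.
Hypothesis mO : measurable Omega.

(* [k], [P], [U] and [G i] stand for the coefficient and for the gradients of
   the adjoint state, of the solution and of [v i]; the right-hand side minus
   the left-hand side is |u - f1|^2 + 2 (int |P|^2 / k - int P . G + Q / 4) with
   f1 = sum c_i v_i, G = sum c_i G_i and Q = int k |G|^2. *)
Lemma energy_bound (k : 'rV[R]_n -> R) (lo hi : R)
    (P U : 'rV[R]_n -> 'rV[R]_n) (G : nat -> 'rV[R]_n -> 'rV[R]_n)
    (u ubar : 'rV[R]_n -> R) (v : nat -> 'rV[R]_n -> R) (l : nat -> R) :
  measurable_fun Omega k -> 0 < lo -> (forall x, lo <= k x <= hi) ->
  L2v Omega P -> L2v Omega U -> (forall i, L2v Omega (G i)) ->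
  L2 Omega u -> L2 Omega ubar -> (forall i, L2 Omega (v i)) ->
  wform Omega (fun x => (k x)^-1) P P = wform Omega (cst 1) U P ->
  wform Omega (cst 1) U P + L2inner Omega u u = L2inner Omega ubar u ->
  (forall i, wform Omega (cst 1) (G i) P + L2inner Omega u (v i) =
             L2inner Omega ubar (v i)) ->
  (forall i j, wform Omega k (G i) (G j) = l i * (i == j)%:R) ->
  forall N (c : nat -> R),
  L2inner Omega (u \- ubar) (u \- ubar) <=
  L2inner Omega (residual N c v ubar) (residual N c v ubar) +
    (\sum_(i < N) l i * c i ^+ 2) / 2.
Proof.
move=> mk lo0 kb PL UL GL uL bL vL PE uE vE Gon N c.
have klo x : lo <= k x by have /andP[] := kb x.
have khi x : k x <= hi by have /andP[] := kb x.
have k0 x : 0 < k x by exact: lt_le_trans (klo x).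
have kle x : `|k x| <= hi by rewrite gtr0_norm.
have kVle x : `|(k x)^-1| <= lo^-1.
  by rewrite gtr0_norm ?invr_gt0// lef_pV2 ?posrE.
have mkV : measurable_fun Omega (fun x => (k x)^-1).
  exact: (measurableT_comp measurable_invr mk).
have m1 : measurable_fun Omega (cst 1 : 'rV[R]_n -> R) by exact: measurable_cst.
have le1 (x : 'rV[R]_n) : `|cst 1 x : R| <= 1 by rewrite normr1.
pose f1 := fun x => \sum_(i < N) c i * v i x.
pose GG := fun x => \sum_(i < N) c i *: G i x.
have f1L : L2 Omega f1 by exact: L2_sum.
have GGL : L2v Omega GG by exact: L2v_sum.
(* The equation tested with f1, obtained by linearity from the tests with the v_i. *)
have SE : wform Omega (cst 1) GG P + L2inner Omega u f1 = L2inner Omega ubar f1.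
  rewrite (L2innerC u) (L2innerC ubar) !(L2inner_suml mO)//.
  rewrite (wform_suml _ mO _ _ m1 le1)// -big_split; apply: eq_bigr => i _.
  by rewrite -(L2innerC ubar) -vE (L2innerC u) [RHS]mulrDr.
have young : wform Omega (cst 1) GG P <=
    wform Omega (fun x => (k x)^-1) P P + wform Omega k GG GG * 4^-1.
  have i1 := wform_integrable _ mO _ _ mkV kVle _ _ PL PL.
  have i2 := integrableZr mO 4^-1 (wform_integrable _ mO _ _ mk kle _ _ GGL GGL).
  rewrite wformC /wform -RintegralZr//; last exact: (wform_integrable _ mO _ _ mk kle).
  rewrite -(RintegralD mO i1 i2); apply: le_Rintegral => //.
  - exact: (wform_integrable _ mO _ _ m1 le1).
  - exact: (integrableD mO i1 i2).
  - by move=> x _; rewrite mul1r; exact: dotp_young.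
have QE := wform_diag _ mO _ _ mk kle N c l _ GL Gon.
rewrite [wform _ _ GG GG]QE in young.
(* Once the squares are expanded the claim is linear: |u - f1|^2 >= 0 plus twice [young], with [uE]
   and [SE] eliminating the products of ubar with u and f1. *)
have := @L2inner_ge0 _ _ Omega (fun x => u x - f1 x).
rewrite (L2inner_subr_sqr mO u f1)// (L2inner_subr_sqr mO u ubar)//.
rewrite (L2inner_subr_sqr mO ubar f1)//; move: uE SE young PE.
rewrite (L2innerC u ubar).
set S := wform _ _ GG P; set T := wform _ _ U P; set T' := wform _ _ P P.
lra.
Qed.

End energy.

(** * The chosen weak gradients and the adjoint state *)

Section gradients.
Context {R : realType} {n : nat} (Omega : set 'rV[R]_n).
Local Notation mu := (@lebesgue_rV R n).

Lemma opB_wform u w :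
  opB Omega u w = wform Omega (cst 1) (grad Omega u) (grad Omega w).
Proof. by apply: eq_Rintegral => x _; rewrite mul1r. Qed.

Lemma grad_L2v u : H1 Omega u -> L2v Omega (grad Omega u).
Proof. by move=> [_ /(xgetPex (fun=> 0))[]]. Qed.

Lemma H1_0 : H1 Omega (fun=> 0).
Proof.
split; first exact: L2_0.
exists (fun=> 0); split => [i|i phi _].
  by under eq_fun do rewrite mxE; exact: L2_0.
rewrite /L2inner; under eq_Rintegral do rewrite mul0r.
under [in RHS]eq_Rintegral do rewrite mxE mul0r.
by rewrite /Rintegral integral0 oppr0.
Qed.

(** Every component of a weak gradient of 0 is orthogonal to all test functions, so the fundamental
    lemma applies to it. *)
Lemma grad0_ae : open Omega ->
  {ae mu, forall x, Omega x -> grad Omega (fun=> 0) x = 0}.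
Proof.
move=> oO; have [_ /(xgetPex (fun=> 0))[gL gw]] := H1_0.
have g0 i : {ae mu, forall x, Omega x -> grad Omega (fun=> 0) x ord0 i = 0}.
  apply: test_orthogonal_ae_eq0 => // phi tphi; have := gw i phi tphi.
  rewrite /L2inner; under eq_Rintegral do rewrite mul0r.
  by rewrite /Rintegral integral0/= => /esym/eqP; rewrite oppr_eq0 => /eqP.
have /filter_forall := g0; apply: filterS => x hx Ox.
by apply/rowP => i; rewrite mxE hx.
Qed.

(* If the equation defining [inverse] has no solution, its value is 0, and both
   sides vanish since the gradient chosen for 0 is 0 almost everywhere. *)
Lemma inverse_opA_energy a u : open Omega ->
    measurable_fun Omega a -> H1 Omega u ->
  let p := inverse Omega (opA Omega a) (opB Omega u) in
  H1 Omega p /\ opA Omega a p p = opB Omega u p.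
Proof.
move=> oO ma Hu p; have mO := open_measurable_rV _ oO.
rewrite /p /inverse; case: xgetP => [w _ [wH weq]|_]; first by split; [case: wH|exact: weq].
split; first exact: H1_0.
have gL := grad_L2v _ H1_0.
rewrite opB_wform; apply: (wform_ae_eq _ mO) => //.
- exact: grad_L2v.
- apply: filterS (grad0_ae oO) => x hx Ox; rewrite (hx Ox).
  by rewrite /dotp !big1 ?mulr0// => i _; rewrite mxE mulr0.
Qed.

End gradients.

(** * The error estimate *)

(** l^s is monotone in s, hence lies between l^0 = 1 and l^1 = l. *)
Lemma min1_le_powR {R : realType} (l s : R) : 0 <= s <= 1 -> 0 < l ->
  Num.min 1 l <= l `^ s.
Proof.
move=> /andP[s0 s1] l0; have [l1|l1] := leP 1 l.
  by rewrite -[leLHS](powRr0 l) ler_powR.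
by rewrite -[leLHS](powRr1 (ltW l0)) ger_powR// l0 ltW.
Qed.

Theorem theorem3 (R : realType) (n : nat) (hn : (1 <= n <= 3)%N)
  (Omega : set 'rV[R]_n) (hOmega : bounded_lipschitz_domain Omega)
  (rho : 'rV[R]_n -> R) (rho_lo rho_hi : R)
  (rho_meas : measurable_fun Omega rho) (rho_lo_gt0 : 0 < rho_lo)
  (rho_bounds : {ae (@lebesgue_rV R n),
     forall x, Omega x -> rho_lo <= rho x <= rho_hi})
  (lambda : nat -> R) (v : nat -> 'rV[R]_n -> R)
  (v_eigen : forall i, weak_eigenpair Omega rho (lambda i) (v i))
  (v_basis : orthonormal_basis Omega v)
  (lambda_gt0 : forall i, 0 < lambda i)
  (lambda_infty : lambda i @[i --> \oo] --> +oo)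
  (s : R) (hs : 0 <= s <= 1)
  (ubar : 'rV[R]_n -> R) (hubar : interpolation_space Omega s ubar)
  (u : 'rV[R]_n -> R) (hu : is_solution Omega rho ubar u) :
  (L2norm Omega (u \- ubar)%R <= Hsnorm Omega lambda v s ubar)%E.
Proof.
have oO : open Omega by case: hOmega.
have mO := open_measurable_rV _ oO.
have [vL von vbasis] := v_basis.
have vH i : H10 Omega (v i) by case: (v_eigen i).
have bL : L2 Omega ubar.
  move: hubar; rewrite /interpolation_space; case: ifP => // _.
  by case: ifP => _; [case=> -[]|case].
have [uH ueq] := hu.
have uL : L2 Omega u by case: uH => -[].
(* rho is bounded only almost everywhere in [Omega]; clamping gives bounds at every point. The upper
   bound is max([rho_lo], [rho_hi]) because the two constants are comparable only through a point
   where the bounds on rho hold. *)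
pose k x := Num.max rho_lo (Num.min (Num.max rho_lo rho_hi) (rho x)).
have mk : measurable_fun Omega k.
  apply: measurable_maxr; first exact: measurable_cst.
  by apply: measurable_minr => //; exact: measurable_cst.
have kb x : rho_lo <= k x <= Num.max rho_lo rho_hi.
  by rewrite /k le_max lexx/= ge_max le_max lexx/= ge_min lexx.
have rhok : {ae (@lebesgue_rV R n), forall x, Omega x -> rho x = k x}.
  apply: filterS rho_bounds => x /= + Ox => /(_ Ox)/andP[h1 h2].
  rewrite /k (max_r (le_trans h1 h2)) (min_r h2) max_r//.
have mVrho : measurable_fun Omega (fun x => (rho x)^-1).
  exact: (measurableT_comp measurable_invr rho_meas).
have mVk : measurable_fun Omega (fun x => (k x)^-1).
  exact: (measurableT_comp measurable_invr mk).
have [pH pE] := inverse_opA_energy _ _ _ oO mVrho uH.1.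
move: ueq pH pE; set p := inverse _ _ _ => ueq pH pE.
have PL := grad_L2v _ _ pH; have UL := grad_L2v _ _ uH.1.
have GL i := grad_L2v _ _ (vH i).1.
pose f i := L2inner Omega ubar (v i).
have key N (c : nat -> R) : L2inner Omega (u \- ubar) (u \- ubar) <=
    L2inner Omega (residual N c v ubar) (residual N c v ubar) +
    (\sum_(i < N) lambda i * c i ^+ 2) / 2.
  apply: (energy_bound mO k _ _ _ _ (fun i => grad Omega (v i)) _ _ _ _
    mk rho_lo_gt0 kb PL UL GL uL bL vL).
  - rewrite -opB_wform -pE; apply: (wform_ae_eq _ mO) => //.
    by apply: filterS rhok => x /= + Ox => /(_ Ox) ->.
  - by rewrite -opB_wform; exact: ueq.
  - by move=> i; rewrite -opB_wform; exact: ueq.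
  - move=> i j; rewrite -von -(v_eigen i).2//.
    apply: (wform_ae_eq _ mO) => //.
    by apply: filterS rhok => x /= + Ox => /(_ Ox) ->.
have bound N : L2inner Omega (u \- ubar) (u \- ubar) <=
    L2inner Omega (residual N f v ubar) (residual N f v ubar) +
    \sum_(i < N) lambda i `^ s * f i ^+ 2.
  (* Modes with lambda_i >= 1 are dropped from the competitor f1, the others keep their Fourier
     coefficient. *)
  apply: le_trans (key N (fun i => if 1 <= lambda i then 0 else f i)) _.
  rewrite !(orthonormal_residual mO)// mulr_suml -!addrA lerD2l -!big_split/=.
  (* Termwise, the claim reads 0 <= (lambda_i^s - 1) f_i^2 for a dropped mode and (lambda_i / 2)
     f_i^2 <= lambda_i^s f_i^2 for a kept one. *)
  apply: ler_sum => i _; rewrite -/(f i).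
  have := min1_le_powR _ _ hs (lambda_gt0 i).
  have l0 := lambda_gt0 i; have f2 := sqr_ge0 (f i).
  case: (leP 1 (lambda i)) => l1 /(ler_wpM2r f2) h; first lra.
  have := mulr_ge0 (ltW l0) f2; lra.
rewrite (L2norm_sqrt mO); last exact: L2B.
rewrite /Hsnorm; set S := (\sum_(0 <= i <oo) _)%E.
have S0 : (0 <= S)%E.
  by apply: nneseries_ge0 => i _ _; rewrite lee_fin mulr_ge0 ?powR_ge0 ?sqr_ge0.
suff XS : ((L2inner Omega (u \- ubar) (u \- ubar))%:E <= S)%E.
  have -> : (Num.sqrt (L2inner Omega (u \- ubar) (u \- ubar)))%:E =
    sqrte (L2inner Omega (u \- ubar) (u \- ubar))%:E by [].
  by rewrite lee_sqrt.
(* Up to e: the residual is made smaller than e by completeness, and the remaining partial sum is at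
   most the series S, which may be infinite. *)
apply/lee_addgt0Pr => e e0.
have [N hN] : exists N, L2inner Omega (residual N f v ubar) (residual N f v ubar) < e.
  (* Completeness is stated for the norm and the residual is its square, hence the threshold
     sqrt(e). *)
  have /fine_cvgP[_ /cvgrPdist_lt/(_ (Num.sqrt e))] := vbasis _ bL.
  rewrite sqrtr_gt0 => /(_ e0)[N _ /(_ N (leqnn N))] /=.
  rewrite -/(residual N f v ubar) (L2norm_sqrt mO); last exact: L2_residual.
  rewrite sub0r normrN ger0_norm ?sqrtr_ge0//= ltr_sqrt// => hN.
  by exists N.
apply: (@le_trans _ _ (e + \sum_(i < N) lambda i `^ s * f i ^+ 2)%:E).
  by rewrite lee_fin (le_trans (bound N))// lerD2r ltW.
rewrite EFinD addeC leeD2r// -sumEFin.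
rewrite -(big_mkord xpredT (fun i => (lambda i `^ s * f i ^+ 2)%:E)).
apply: nneseries_lim_ge => i _ _.
by rewrite lee_fin mulr_ge0 ?powR_ge0 ?sqr_ge0.
Qed.
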